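(* Let $d\ge2$ be an integer, let $d_0=1$ and $d_j=d$ for all $j\ge1$, and let $\bar p=(p_j)_{j\ge 1}$ with $p_j\in(0,1]$. If $\lim_{j\to\infty}p_j=1$ and $p_j\ge2(\sqrt2-1)$ for all integers $j\ge1$, then $\sigma_p(c_0,\bar d,\bar p)$ equals the interior of $E_{\bar d,\bar p}$.
   Context: $\mathbb{Z}_+=\{0,1,2,\dots\}$, $\bar d=(d_j)_{j\ge0}$. Put $q_j=d_0d_1\cdots d_j$ for $j\ge 0$. Every $n\in\mathbb{Z}_+$ has a unique expansion $n=\sum_{j\ge1}a_j(n)q_{j-1}$ with digits $a_j(n)\in\{0,\dots,d_j-1\}$, only finitely many nonzero. Put $\zeta_n=\min\{j\ge1: a_j(n)\ne d_j-1\}$. Let $S=[s(n,m)]_{n,m\ge0}$ be the stochastic matrix with entries: $s(n,n+1)=\prod_{j=1}^{\zeta_n}p_j$; $s(n,n)=1-p_1$; if $\zeta_n\ge2$, for $1\le r\le\zeta_n-1$, $s\big(n,\,n-\sum_{j=1}^r(d_j-1)q_{j-1}\big)=(1-p_{r+1})\prod_{j=1}^rp_j$; and $s(n,m)=0$ otherwise. $(Sw)(n)=\sum_m s(n,m)w(m)$ defines a bounded linear operator on $c_0$ (complex sequences indexed by $\mathbb{Z}_+$ tending to $0$, sup norm). $\sigma_p(c_0,\bar d,\bar p)$ denotes the point spectrum (set of eigenvalues) of $S$ acting on $c_0$. For $j\ge1$ let $f_j(z)=\left(\frac{z-(1-p_j)}{p_j}\right)^{d_j}$, $z\in\mathbb{C}$,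 and $\tilde f_j=f_j\circ\cdots\circ f_1$. Put $E_{\bar d,\bar p}=\{z\in\mathbb{C}:\limsup_{j\to\infty}|\tilde f_j(z)|<+\infty\}$. *)

(* Defs.v *)
From HB Require Import structures.
From mathcomp Require Import all_boot all_order all_algebra.
From mathcomp Require Import complex.
From mathcomp Require Import all_classical all_reals all_analysis.

Set Implicit Arguments.
Unset Strict Implicit.
Unset Printing Implicit Defensive.

Import Order.TTheory GRing.Theory Num.Theory.
Import numFieldNormedType.Exports.
Local Open Scope classical_set_scope.
Local Open Scope ring_scope.

(* Typing R[i] as a numClosedFieldType is what gives it the topology of its
   modulus. *)
Definition Cplx (R : realType) : numClosedFieldType := R[i].

Definition toC {R : realType} (x : R) : Cplx R := x%:C%C.

(* The modulus, as an element of R rather than of R[i]. *)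
Definition modC {R : realType} (z : Cplx R) : R := ComplexField.Normc.normc z.

Section Digits.
Local Open Scope nat_scope.

Definition q (d : nat -> nat) (j : nat) : nat := \prod_(0 <= i < j.+1) d i.

(* Meaningful for j >= 1; see [digit_expansion] and [digit_unique]. *)
Definition digit (d : nat -> nat) (j n : nat) : nat := n %/ q d j.-1 %% d j.

(* Scanning j = 1, ..., n + 1 is enough, since the digit of n of index n + 1 is
   0; see [zeta_min]. *)
Definition zeta (d : nat -> nat) (n : nat) : nat :=
  (find (fun j => digit d j n != (d j).-1) (iota 1 n.+1)).+1.

Lemma qS d j : q d j.+1 = q d j * d j.+1.
Proof. by rewrite /q big_nat_recr. Qed.

Lemma q0 d : d 0 = 1 -> q d 0 = 1.
Proof. by move=> d0; rewrite /q big_nat1. Qed.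

Lemma ltn_q d j : d 0 = 1 -> (forall j, 1 <= j -> 2 <= d j) -> j < q d j.
Proof.
move=> d0 d2; elim: j => [|j IH]; first by rewrite q0.
rewrite qS; apply: (@leq_trans (q d j * 2)); last by rewrite leq_mul2l d2 ?orbT.
by rewrite muln2 -addnn -[j.+2]add1n leq_add // (leq_trans _ IH).
Qed.

Lemma digit_lt d j n : (forall j, 1 <= j -> 2 <= d j) -> 1 <= j ->
  digit d j n < d j.
Proof. by move=> d2 j1; rewrite ltn_mod (leq_trans _ (d2 _ j1)). Qed.

Lemma digit_eq0 d j n : d 0 = 1 -> (forall j, 1 <= j -> 2 <= d j) -> n < j ->
  digit d j n = 0.
Proof.
case: j => // j d0 d2 nj; rewrite /digit /= divn_small ?mod0n //.
by rewrite (leq_ltn_trans _ (ltn_q j d0 d2)).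
Qed.

Lemma digit_partial d n k : d 0 = 1 ->
  n = \sum_(1 <= j < k.+1) digit d j n * q d j.-1 + n %/ q d k * q d k.
Proof.
move=> d0; elim: k => [|k IH]; first by rewrite big_geq // q0 // divn1 muln1.
rewrite big_nat_recr //= {1}IH -addnA; congr (_ + _).
rewrite {1}(divn_eq (n %/ q d k) (d k.+1)) mulnDl addnC; congr (_ + _).
by rewrite -divnMA qS -mulnA (mulnC (d _)).
Qed.

Lemma digit_expansion d n : d 0 = 1 -> (forall j, 1 <= j -> 2 <= d j) ->
  n = \sum_(1 <= j < n.+1) digit d j n * q d j.-1.
Proof.
move=> d0 d2; rewrite {1}(digit_partial n n d0).
by rewrite (divn_small (ltn_q n d0 d2)) mul0n addn0.
Qed.

Lemma expansion_lt d (a : nat -> nat) k : d 0 = 1 ->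
  (forall j, 1 <= j -> a j < d j) ->
  \sum_(1 <= j < k.+1) a j * q d j.-1 < q d k.
Proof.
move=> d0 ad; elim: k => [|k IH]; first by rewrite big_geq // q0.
rewrite big_nat_recr //= qS -addSn (@leq_trans (q d k + a k.+1 * q d k)) //.
  by rewrite leq_add2r.
by rewrite -mulSn mulnC leq_mul2l ad // orbT.
Qed.

Lemma digit_unique d (a : nat -> nat) n N : d 0 = 1 ->
  (forall j, 1 <= j -> a j < d j) ->
  n = \sum_(1 <= j < N.+1) a j * q d j.-1 ->
  forall j, 1 <= j <= N -> a j = digit d j n.
Proof.
move=> d0 ad; elim: N n => [|N IH] n nE j /andP[j1 jN].
  by move: (leq_trans j1 jN).
have lt_q := expansion_lt N d0 ad.
have qN0 : 0 < q d N by rewrite (leq_ltn_trans _ lt_q).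
rewrite big_nat_recr //= in nE; set m := (X in n = X + _) in nE lt_q.
move: jN; rewrite leq_eqVlt => /orP[/eqP -> | jN].
  by rewrite /digit /= nE addnC divnMDl // divn_small // addn0 modn_small // ad.
rewrite (IH m erefl j) ?j1 // /digit.
have [c qE] : exists c, q d N = q d j.-1 * d j * c.
  have {}jN : j <= N by [].
  case: j j1 jN => // j _ jN /=; rewrite -qS.
  exists (\prod_(j.+2 <= i < N.+1) d i).
  by rewrite /q -big_cat_nat.
have qj : 0 < q d j.-1 by move: qN0; rewrite qE; case: (q d j.-1).
rewrite nE qE (_ : a N.+1 * _ = a N.+1 * c * d j * q d j.-1).
  by rewrite addnC divnMDl // modnMDl.
by rewrite -!mulnA; congr (_ * _); rewrite [RHS]mulnC [_ * q d _]mulnC mulnA mulnC.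
Qed.

Lemma zeta_min d n : d 0 = 1 -> (forall j, 1 <= j -> 2 <= d j) ->
  [/\ 1 <= zeta d n, digit d (zeta d n) n != (d (zeta d n)).-1 &
      forall j, 1 <= j < zeta d n -> digit d j n = (d j).-1].
Proof.
move=> d0 d2; rewrite /zeta; set P := fun j => _; set s := iota 1 _.
have hasP : has P s.
  apply/hasP; exists n.+1; first by rewrite mem_iota /= add1n ltnSn.
  by rewrite /P digit_eq0 //; move: (d2 n.+1 isT); case: (d n.+1) => [|[]].
have lts : find P s < n.+1 by move: hasP; rewrite has_find size_iota.
split => //; first by have := nth_find 0 hasP; rewrite nth_iota // add1n.
case=> [|j] // /andP[_]; rewrite ltnS => jz; have jn := ltn_trans jz lts.
by have := before_find 0 jz; rewrite nth_iota // => /negbFE/eqP.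
Qed.

End Digits.

Section Matrix.
Variable R : realType.
Implicit Types (d : nat -> nat) (p : nat -> R).

(* n - \sum_j (d_j - 1) q_(j-1) is written on the side of m, as subtraction on
   nat is truncated; distinct r give distinct m, so at most one term of the sum
   below is nonzero. *)
Definition smatrix d p (n m : nat) : R :=
  if m == n.+1 then \prod_(1 <= j < (zeta d n).+1) p j
  else if m == n then 1 - p 1%N
  else \sum_(1 <= r < zeta d n |
             n == (m + \sum_(1 <= j < r.+1) (d j).-1 * q d j.-1)%N)
         (1 - p r.+1) * \prod_(1 <= j < r.+1) p j.

Definition c0 : set (nat -> Cplx R) := [set w | w @ \oo --> (0 : Cplx R)].

(* Each row of the matrix has finitely many nonzero entries, so the series
   converges for every w; see [Sop_finite]. *)
Definition Sop d p (w : nat -> Cplx R) (n : nat) : Cplx R :=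
  limn (series (fun m => toC (smatrix d p n m) * w m)).

Lemma smatrix_eq0 d p n m : (n.+1 < m)%N -> smatrix d p n m = 0.
Proof.
move=> nm; have nm' : (n < m)%N by apply: ltn_trans nm.
rewrite /smatrix !gtn_eqF // big_pred0 // => r.
by apply: ltn_eqF; rewrite ltn_addr.
Qed.

Lemma Sop_finite d p w n :
  Sop d p w n = \sum_(0 <= m < n.+2) toC (smatrix d p n m) * w m.
Proof.
apply: cvg_lim; first exact: norm_hausdorff.
apply: cvg_near_cst; exists n.+2 => // k /= nk.
rewrite /series /= (big_cat_nat _ nk) //= [X in _ + X]big_nat_cond.
rewrite [X in _ + X]big1 ?addr0 // => m /andP[/andP[nm _] _].
by rewrite smatrix_eq0 // /toC rmorph0 mul0r.
Qed.

Definition point_spectrum d p : set (Cplx R) :=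
  [set l | exists w : nat -> Cplx R,
     [/\ c0 w, exists n, w n <> 0 & forall n, Sop d p w n = l * w n]].

Definition f d p (j : nat) (z : Cplx R) : Cplx R :=
  ((z - toC (1 - p j)) / toC (p j)) ^+ d j.

(* ftilde 0 is the identity; this does not affect the limsup. *)
Fixpoint ftilde d p (j : nat) (z : Cplx R) : Cplx R :=
  if j is k.+1 then f d p k.+1 (ftilde d p k z) else z.

Definition Eset d p : set (Cplx R) :=
  [set z | (limn_esup (fun j => (modC (ftilde d p j z))%:E) < +oo)%E].

End Matrix.

(* Main.v *)
(* Put z_j = ftilde_j(l) and u_j = (z_(j-1) - (1 - p_j)) / p_j, so that
   z_j = u_j^d. Row n of S has a nonzero entry in column n + 1 and none beyond,
   so an eigenvector for l is determined by its value at 0; it is the product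
   of the u_j^(a_j(n)), up to a scalar. This product tends to 0 iff u_j does,
   that is, as p_j -> 1, iff z_j -> 0.

   The set E consists of the l with |z_j| <= 1 for all j, because |f_j(z)| >=
   |z|^d outside the unit disc. For large j the map f_j is close to z^d, so an
   orbit that enters the disc of radius 3/4 late enough tends to 0; hence
   z_j -> 0 is an open condition, and implies that l is interior to E.

   Conversely let l be interior to E and suppose that z_j does not tend to 0.
   The bound on p_j makes the disc of radius (sqrt 2 - 1)^2 invariant under all
   the f_j; as it contains the critical values (all equal to 0), no u_j
   vanishes, so that ftilde_j'(l), the product of the d u_i^(d-1) / p_i, is
   nonzero. Since |z_j| > 3/4 for large j, its factors have modulus at least 3/2
   from some point on, and it is unbounded. But |ftilde_j| <= 1 near l, so that
   Cauchy's estimate for polynomials bounds it. *)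

Require Import Defs.
From HB Require Import structures.
From mathcomp Require Import all_boot all_order all_algebra.
From mathcomp Require Import complex.
From mathcomp Require Import all_classical all_reals all_analysis.
From mathcomp Require Import cyclic separable cyclotomic zify ring lra.

Set Implicit Arguments.
Unset Strict Implicit.
Unset Printing Implicit Defensive.

Import Order.TTheory GRing.Theory Num.Theory.
Import numFieldNormedType.Exports.
Local Open Scope classical_set_scope.
Local Open Scope ring_scope.

(** * Roots of unity and Cauchy's estimate for polynomials *)

Lemma unity_root_power_sum (K : idomainType) (n : nat) (x : K) :
  x ^+ n = 1 -> x != 1 -> \sum_(k < n) x ^+ k = 0.
Proof.
move=> xn x1; apply: (mulfI (_ : x - 1 != 0)); first by rewrite subr_eq0.
by rewrite -subrX1 xn subrr mulr0.
Qed.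

(** In characteristic 0 the split polynomial ['X^n - 1] is separable, so it has [n] distinct roots,
    and these include a primitive one. *)
Lemma prim_root_exists (C : numClosedFieldType) (n : nat) :
  (0 < n)%N -> exists z : C, n.-primitive_root z.
Proof.
move=> n0; have [r] := closed_field_poly_normal ('X^n - 1 : {poly C}).
rewrite (monicP (monicXnsubC _ n0)) scale1r => rE.
suff /hasP[z _ zn] : has n.-primitive_root r by exists z.
apply: has_prim_root => //.
- by apply/allP => z; rewrite -root_prod_XsubC -rE.
- by rewrite -separable_prod_XsubC -rE separable_Xn_sub_1 ?pnatr_eq0 -?lt0n.
- by rewrite -ltnS -(size_prod_XsubC r id) -rE size_XnsubC.
Qed.

(* Averaging P(rho w^k) w^-k over the n-th roots of unity w^k, with n larger
   than the degree, isolates the coefficient of degree 1; the exponent n.-1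
   stands for -1. *)
Lemma cauchy_estimate0 (C : numClosedFieldType) (P : {poly C}) (rho : C) :
  0 < rho -> (forall z, `|z| <= rho -> `|P.[z]| <= 1) -> `|P`_1| * rho <= 1.
Proof.
move=> rho0 P1; pose n := (size P).+2.
have [w pw] := @prim_root_exists C n isT.
have wn := prim_expr_order pw.
have w1 : `|w| = 1.
  by apply/eqP; rewrite -(@pexpr_eq1 _ _ n) // -normrX wn normr1.
have H : \sum_(k < n) (w ^+ k) ^+ n.-1 * P.[rho * w ^+ k] = n%:R * (P`_1 * rho).
  under eq_bigr => k _ do rewrite (@horner_coef_wide _ n) ?leqW // mulr_sumr.
  rewrite exchange_big /=.
  have termE (i k : 'I_n) : (w ^+ k) ^+ n.-1 * (P`_i * (rho * w ^+ k) ^+ i) =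
      P`_i * rho ^+ i * (w ^+ (i + n.-1)) ^+ k.
    rewrite addnC exprD [in RHS]exprMn exprMn [(w ^+ n.-1) ^+ k]exprAC.
    rewrite [(w ^+ i) ^+ k]exprAC mulrCA -!mulrA.
    by congr (_ * _); rewrite mulrCA.
  under eq_bigr => i _ do under eq_bigr => k _ do rewrite termE.
  rewrite (bigD1 (Ordinal (isT : (1 < n)%N))) //=.
  rewrite [X in _ + X]big1 ?addr0 => [|i i1].
    rewrite -mulr_sumr wn expr1; under eq_bigr do rewrite expr1n.
    by rewrite sumr_const card_ord mulr_natl mulr_natr.
  rewrite -mulr_sumr unity_root_power_sum ?mulr0 //.
    by rewrite exprAC wn expr1n.
  (* As [i < n], the exponent [i + n.-1] lies between [n - 1] and [2n - 2]; the only multiple of [n]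
     there is [n] itself, at [i = 1]. *)
  rewrite -(prim_order_dvd pw); apply: contra i1 => /dvdnP[c ce].
  apply/eqP/val_inj => /=; have := ltn_ord i; move: ce.
  by rewrite /n; case: c => [|[|c]] /=; rewrite ?mulSn; lia.
have n0 : 0 < n%:R :> C by rewrite ltr0n.
rewrite -(ler_pM2l n0) mulr1 -{1}(gtr0_norm rho0) -normrM.
rewrite -{1}[n%:R]gtr0_norm // -normrM -H.
apply: le_trans (ler_norm_sum _ _ _) _.
have -> : n%:R = \sum_(k < n) 1 :> C by rewrite sumr_const card_ord.
apply: ler_sum => k _.
rewrite normrM !normrX w1 !expr1n mul1r P1 // normrM normrX w1 expr1n mulr1.
by rewrite gtr0_norm.
Qed.

Lemma cauchy_estimate (C : numClosedFieldType) (P : {poly C}) (a rho : C) :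
  0 < rho -> (forall z, `|z - a| <= rho -> `|P.[z]| <= 1) ->
  `|P^`().[a]| * rho <= 1.
Proof.
move=> rho0 P1; have := @cauchy_estimate0 C (P \Po ('X + a%:P)) rho rho0.
have -> : (P \Po ('X + a%:P))`_1 = P^`().[a].
  have <- : (P \Po ('X + a%:P))^`().[0] = P^`().[a].
    rewrite deriv_comp derivD derivX derivC addr0 mulr1 horner_comp.
    by rewrite !hornerE.
  by rewrite horner_coef0 coef_deriv.
apply=> z zr; rewrite horner_comp P1 //.
by rewrite !hornerE addrK.
Qed.

(** * Products indexed by base-[d] digits *)

Section DigitProduct.
Variables (K : comPzRingType) (d : nat).
Hypothesis d1 : (1 < d)%N.
Implicit Types (u : nat -> K).

Definition shift (k : nat) u : nat -> K := fun i => u (k + i)%N.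

(* The digits of index at least n of n vanish. *)
Definition digit_prod u (n : nat) : K := \prod_(i < n) u i ^+ (n %/ d ^ i %% d).

Lemma digit_prod_wide u n N :
  (n <= N)%N -> digit_prod u n = \prod_(i < N) u i ^+ (n %/ d ^ i %% d).
Proof.
move=> nN; rewrite /digit_prod.
rewrite -!(big_mkord xpredT (fun i => u i ^+ (n %/ d ^ i %% d))).
rewrite (@big_cat_nat _ _ _ n 0 N) //= [X in _ * X]big_nat_cond.
rewrite [X in _ * X]big1 ?mulr1 // => i /andP[/andP[ni _] _].
by rewrite divn_small ?mod0n // (leq_ltn_trans ni) // ltn_expl.
Qed.

Lemma digit_prod0 u : digit_prod u 0 = 1.
Proof. by rewrite /digit_prod big_ord0. Qed.

(** Splitting off the last digit: the recursion behind most inductions below. *)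
Lemma digit_prodE u n :
  digit_prod u n = u 0%N ^+ (n %% d) * digit_prod (shift 1 u) (n %/ d).
Proof.
rewrite (@digit_prod_wide _ _ n.+1) // big_ord_recl expn0 divn1.
rewrite (@digit_prod_wide _ (n %/ d) n) ?leq_div //; congr (_ * _).
by apply: eq_bigr => i _; rewrite /= expnS divnMA.
Qed.

Lemma digit_prod_mulX u k n :
  digit_prod u (n * d ^ k) = digit_prod (shift k u) n.
Proof.
elim: k u => [|k IH] u; first by rewrite muln1.
rewrite digit_prodE expnSr mulnA modnMl mulnK ?IH ?mul1r //; lia.
Qed.

(** The argument is [n] followed by [k] digits equal to [d.-1]. *)
Lemma digit_prod_predX u k n :
  digit_prod u (n * d ^ k + (d ^ k).-1) =
  (\prod_(i < k) u i ^+ d.-1) * digit_prod (shift k u) n.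
Proof.
elim: k u => [|k IH] u; first by rewrite big_ord0 mul1r muln1 addn0.
have dk : (0 < d ^ k)%N by rewrite expn_gt0; lia.
have -> : (n * d ^ k.+1 + (d ^ k.+1).-1 =
           (n * d ^ k + (d ^ k).-1) * d + d.-1)%N by rewrite expnSr; nia.
rewrite digit_prodE modnMDl modn_small ?divnMDl; try lia.
rewrite divn_small ?addn0; last by lia.
by rewrite IH big_ord_recl mulrA.
Qed.

Lemma digit_prod_succ u n :
  (n %% d != d.-1)%N -> digit_prod u n.+1 = u 0%N * digit_prod u n.
Proof.
move=> nd; have nd' : (n %% d < d.-1)%N.
  by rewrite ltn_neqAle nd -ltnS prednK ?ltn_mod; lia.
rewrite !(digit_prodE u) mulrA -exprS.
have nE : (n.+1 = (n %/ d) * d + (n %% d).+1)%N by rewrite addnS -divn_eq.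
have -> : (n.+1 %% d = (n %% d).+1)%N by rewrite nE modnMDl modn_small //; lia.
suff -> : (n.+1 %/ d = n %/ d)%N by [].
by rewrite nE divnMDl ?(divn_small (m := _.+1)) ?addn0 //; lia.
Qed.

End DigitProduct.

(** * Eigenvectors *)

Section Eigenvectors.
Variables (R : realType) (d : nat) (dbar : nat -> nat) (p : nat -> R).
Hypothesis d1 : (1 < d)%N.
Hypothesis dbar0 : dbar 0%N = 1%N.
Hypothesis dbarE : forall j, (1 <= j)%N -> dbar j = d.
Hypothesis p01 : forall j, (1 <= j)%N -> 0 < p j <= 1.
Implicit Types (w : nat -> Cplx R) (l : Cplx R).

Lemma q_const k : q dbar k = (d ^ k)%N.
Proof.
by elim: k => [|k IH]; [rewrite q0 | rewrite qS IH dbarE // expnSr].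
Qed.

Lemma sum_pred_q r :
  (\sum_(1 <= j < r.+1) (dbar j).-1 * q dbar j.-1 = (d ^ r).-1)%N.
Proof.
elim: r => [|r IH]; first by rewrite big_geq.
rewrite big_nat_recr //= IH q_const dbarE // expnSr.
have : (0 < d ^ r)%N by rewrite expn_gt0; lia.
nia.
Qed.

(** Here [k] counts the trailing digits of [n] equal to [d.-1], and [m] is what precedes them. *)
Lemma zeta_decomp n : exists k m, [/\ zeta dbar n = k.+1,
  n = (m * d ^ k + (d ^ k).-1)%N & (m %% d != d.-1)%N].
Proof.
have dbar2 j : (1 <= j)%N -> (2 <= dbar j)%N by move=> /dbarE ->.
have [+ + +] := zeta_min n dbar0 dbar2.
case: (zeta dbar n) => [//|k] _; rewrite /digit /= q_const dbarE // => nk H.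
exists k, (n %/ d ^ k)%N; split=> //.
have {H} H j : (j < k)%N -> (n %/ d ^ j %% d = d.-1)%N.
  by move=> jk; have := H j.+1; rewrite /= q_const dbarE //; apply.
rewrite {1}(divn_eq n (d ^ k)); congr (_ + _)%N.
elim: k {nk} H => [|k IH] H; first by rewrite modn1.
have dk : (0 < d ^ k)%N by rewrite expn_gt0; lia.
have {}IH : (n %% d ^ k = (d ^ k).-1)%N by apply: IH => j jk; apply/H/ltnW.
have := divn_eq n (d ^ k); have := divn_eq (n %/ d ^ k) d.
rewrite (H k) // IH => -> nE; rewrite nE expnSr.
rewrite mulnDl -mulnA [(d * _)%N]mulnC -addnA modnMDl modn_small; nia.
Qed.

Let P r : R := \prod_(1 <= j < r.+1) p j.

Lemma prod_p0 : P 0 = 1.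
Proof. by rewrite /P big_geq. Qed.

Lemma prod_p_gt0 r : 0 < P r.
Proof.
rewrite /P big_nat_cond; apply: prodr_gt0 => j /andP[/andP[j1 _] _].
by case/andP: (p01 j1).
Qed.

(** Subtracting [(d ^ r).-1] from [n] turns its last [r] digits into zeros, whence the form of the
    column indices; [r = 0] is the diagonal entry. *)
Lemma Sop_row w n k m : zeta dbar n = k.+1 ->
  n = (m * d ^ k + (d ^ k).-1)%N ->
  Sop dbar p w n = toC (P k.+1) * w n.+1 +
    \sum_(0 <= r < k.+1) toC ((1 - p r.+1) * P r) *
       w ((m * d ^ (k - r) + (d ^ (k - r)).-1) * d ^ r)%N.
Proof.
move=> zn nE; have idxE r : (r <= k)%N ->
    ((m * d ^ (k - r) + (d ^ (k - r)).-1) * d ^ r = n - (d ^ r).-1)%N /\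
    ((d ^ r).-1 <= n)%N.
  move=> rk; have : (d ^ k = d ^ (k - r) * d ^ r)%N by rewrite -expnD subnK.
  have : (0 < d ^ r)%N by rewrite expn_gt0; lia.
  have : (0 < d ^ (k - r))%N by rewrite expn_gt0; lia.
  rewrite nE; move: (d ^ k)%N (d ^ r)%N (d ^ (k - r))%N => x y z z0 y0 ->; nia.
rewrite Sop_finite (@big_nat_recr _ _ _ n.+1) //= (@big_nat_recr _ _ _ n) //=.
rewrite addrC; congr (_ + _); first by rewrite /smatrix eqxx zn.
rewrite big_nat_recl // addrC.
rewrite {1}/smatrix ltn_eqF // eqxx prod_p0 mulr1.
have [-> _] := idxE 0%N isT; rewrite expn0 subn0; congr (_ + _).
rewrite big_mkord.
transitivity (\sum_(i < n) \sum_(0 <= r < k)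
   (if n == (i + (d ^ r.+1).-1)%N then
      toC ((1 - p r.+2) * \prod_(1 <= j < r.+2) p j) * w i else 0)).
  apply: eq_bigr => i _; rewrite /smatrix !ltn_eqF ?ltn_ord ?ltnS 1?ltnW //.
  rewrite zn /toC rmorph_sum mulr_suml big_mkcond big_add1 /=.
  by apply: eq_bigr => r _; rewrite sum_pred_q.
rewrite exchange_big /=; apply: eq_big_nat => r /andP[_ rk].
have [-> le_n] := idxE r.+1 rk.
have dr : (1 < d ^ r.+1)%N by rewrite -{1}(expn0 d) ltn_exp2l.
have lt_n : (n - (d ^ r.+1).-1 < n)%N by lia.
rewrite (bigD1 (Ordinal lt_n)) //= subnK // eqxx.
rewrite [X in _ + X]big1 ?addr0 // => i.
by case: ifP => // /eqP ni; rewrite -val_eqE /= {2}ni addnK eqxx.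
Qed.

(* The u_(j+1) of the header. *)
Definition multiplier l (j : nat) : Cplx R :=
  (ftilde dbar p j l - toC (1 - p j.+1)) / toC (p j.+1).

Lemma toC_p_neq0 j : toC (p j.+1) != 0.
Proof.
have /andP[pj _] := p01 (isT : (1 <= j.+1)%N).
by rewrite /toC fmorph_eq0 gt_eqF.
Qed.

Lemma ftildeS l j : ftilde dbar p j.+1 l = multiplier l j ^+ d.
Proof. by rewrite /= /f dbarE. Qed.

Lemma multiplierE l j :
  toC (p j.+1) * multiplier l j = ftilde dbar p j l - toC (1 - p j.+1).
Proof. by rewrite mulrC divfK // toC_p_neq0. Qed.

(** Induction on [k]: multiplying by [u_k ^+ d.-1], where [u_k] is [multiplier l k], turns [u_k]
    into [ftilde_(k+1)], that is [p_(k+2) u_(k+1) + (1 - p_(k+2))]. These two summands give the new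
    leading term and the new term of the sum. *)
Lemma multiplier_telescope l k :
  toC (P k.+1) * multiplier l k +
  \sum_(0 <= r < k.+1) toC ((1 - p r.+1) * P r) *
     \prod_(0 <= i < k - r) multiplier l (r + i) ^+ d.-1 =
  l * \prod_(0 <= i < k) multiplier l i ^+ d.-1.
Proof.
have PS r : toC (P r.+1) = toC (P r) * toC (p r.+1).
  by rewrite /toC -rmorphM /P big_nat_recr.
elim: k => [|k IH].
  rewrite big_nat1 !big_geq // !mulr1 PS prod_p0 /toC rmorph1 mul1r.
  by rewrite multiplierE mulr1 subrK.
rewrite [in RHS]big_nat_recr //= mulrA -{}IH.
rewrite mulrDl -mulrA -exprS prednK; last by lia.
rewrite -ftildeS PS -mulrA multiplierE big_nat_recr //= subnn.
rewrite [\prod_(0 <= i < 0) _]big_geq // mulr1 mulr_suml.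
rewrite (_ : toC ((1 - p k.+2) * P k.+1) = toC (P k.+1) * toC (1 - p k.+2)).
  rewrite addrCA addrA -addrA -mulrDr subrK addrC; congr (_ + _).
  apply: eq_big_nat => r /andP[_ rk]; rewrite -mulrA; congr (_ * _).
  by rewrite subSn // big_nat_recr //= subnKC.
by rewrite /toC rmorphM mulrC.
Qed.

Lemma Sop_digit_prod l n :
  Sop dbar p (digit_prod d (multiplier l)) n =
  l * digit_prod d (multiplier l) n.
Proof.
have [k [m [zn nE md]]] := zeta_decomp n.
rewrite (Sop_row _ zn nE) [in RHS]nE digit_prod_predX // mulrA.
rewrite -(big_mkord xpredT (fun i => multiplier l i ^+ d.-1)).
rewrite -multiplier_telescope mulrDl.
have -> : n.+1 = (m.+1 * d ^ k)%N.
  by rewrite nE -addnS prednK ?expn_gt0; lia.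
rewrite digit_prod_mulX // digit_prod_succ // {1}/shift addn0 mulrA.
congr (_ + _); rewrite mulr_suml; apply: eq_big_nat => r /andP[_ rk].
rewrite digit_prod_mulX // digit_prod_predX // mulrA.
rewrite -(big_mkord xpredT (fun i => shift r (multiplier l) i ^+ d.-1)).
congr (_ * digit_prod _ _ _); apply/funext => i; rewrite /shift.
by congr multiplier; lia.
Qed.

(** Row [n] determines [w n.+1] from earlier values, as its coefficient [P k.+1] is nonzero;
    [digit_prod] obeys the same recursion. *)
Lemma eigenvector_digit_prod l w : (forall n, Sop dbar p w n = l * w n) ->
  forall n, w n = w 0%N * digit_prod d (multiplier l) n.
Proof.
move=> wl; elim/ltn_ind => -[_|n IH]; first by rewrite digit_prod0 mulr1.
have [k [m [zn nE md]]] := zeta_decomp n.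
have Pk : toC (P k.+1) != 0 by rewrite /toC fmorph_eq0 gt_eqF // prod_p_gt0.
apply: (mulfI Pk); have /eqP := wl n.
rewrite (Sop_row _ zn nE) -subr_eq0 -addrA addr_eq0 => /eqP ->.
rewrite IH // [RHS]mulrCA; have /eqP := Sop_digit_prod l n.
rewrite (Sop_row _ zn nE) -subr_eq0 -addrA addr_eq0 => /eqP ->.
rewrite mulrN [in RHS]mulrBr mulrCA; congr (- (_ - _)).
rewrite mulr_sumr; apply: eq_big_nat => r /andP[_ rk].
rewrite [RHS]mulrCA; congr (_ * _); apply: IH; rewrite ltnS nE.
have -> : (d ^ k = d ^ (k - r) * d ^ r)%N by rewrite -expnD subnK.
have : (0 < d ^ r)%N by rewrite expn_gt0; lia.
have : (0 < d ^ (k - r))%N by rewrite expn_gt0; lia.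
move: (d ^ r)%N (d ^ (k - r))%N => y z z0 y0; nia.
Qed.

End Eigenvectors.

(** * Real-valued modulus and decay of digit products *)

Section Modulus.
Variable R : realType.
Implicit Types (x y z : Cplx R) (w : nat -> Cplx R).

Lemma normr_modC z : `|z| = toC (modC z). Proof. by []. Qed.

Lemma modC_ge0 z : 0 <= modC z.
Proof. by rewrite -ler0c -[X in _ <= X]/(`|z|). Qed.

Lemma modCM x y : modC (x * y) = modC x * modC y.
Proof. exact: ComplexField.Normc.normcM. Qed.

Lemma modC0 : modC (0 : Cplx R) = 0.
Proof. exact: ComplexField.Normc.normc0. Qed.

Lemma modC1 : modC (1 : Cplx R) = 1.
Proof. exact: ComplexField.Normc.normc1. Qed.

Lemma modC_gt0 z : z != 0 -> 0 < modC z.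
Proof.
rewrite lt_neqAle modC_ge0 andbT; apply: contra_neqT; rewrite negbK => /eqP.
by move=> /esym; exact: ComplexField.Normc.eq0_normc.
Qed.

Lemma modCX z n : modC (z ^+ n) = modC z ^+ n.
Proof.
by elim: n => [|n IH]; rewrite ?expr0 ?modC1 // !exprS modCM IH.
Qed.

Lemma modC_toC (a : R) : 0 <= a -> modC (toC a) = a.
Proof.
by move=> a0; rewrite /modC /toC /= expr0n /= addr0 sqrtr_sqr ger0_norm.
Qed.

Lemma modCD x y : modC (x + y) <= modC x + modC y.
Proof.
have := ler_normD x y; rewrite !normr_modC /toC -rmorphD.
by rewrite (lecR (modC (x + y))).
Qed.

Lemma modCN z : modC (- z) = modC z.
Proof. by apply: complexI; exact: (normrN (z : Cplx R)). Qed.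

Lemma modC_div x (a : R) : 0 < a -> modC (x / toC a) = modC x / a.
Proof.
move=> a0; have a0' : toC a != 0 by rewrite /toC fmorph_eq0 gt_eqF.
apply: (mulIf (lt0r_neq0 a0)); rewrite (divfK (lt0r_neq0 a0)).
by rewrite -[X in _ * X = _](modC_toC (ltW a0)) -modCM divfK.
Qed.

Lemma c0P w : c0 w <->
  forall e : R, 0 < e -> exists N, forall n, (N <= n)%N -> modC (w n) < e.
Proof.
split=> [/cvgr0Pnorm_lt w0 e e0|H].
  have [|N _ HN] := w0 (toC e); first by rewrite /toC (ltcR 0).
  by exists N => n Nn; have := HN n Nn; rewrite /= normr_modC /toC ltcR.
apply/cvgr0Pnorm_lt => e e0.
have eE : e = toC (modC e) by rewrite -normr_modC gtr0_norm.
have e0' : 0 < modC e by move: e0; rewrite {1}eE /toC (ltcR 0).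
have [N HN] := H (modC e) e0'.
by exists N => // n Nn /=; rewrite [X in _ < X]eE normr_modC /toC ltcR HN.
Qed.

Variable d : nat.
Hypothesis d1 : (1 < d)%N.

Lemma modC_digit_prod_le1 w n :
  (forall i, modC (w i) <= 1) -> modC (digit_prod d w n) <= 1.
Proof.
elim/ltn_ind: n w => -[|n] IH w w1; first by rewrite digit_prod0 modC1.
rewrite digit_prodE // modCM modCX mulr_ile1 ?exprn_ge0 ?modC_ge0 //.
  by rewrite exprn_ile1 ?modC_ge0.
by apply: IH => [|i]; [rewrite ltn_Pdiv | exact: w1].
Qed.

(** Some digit of [n] of index at least [k] is nonzero; it contributes a factor of modulus at most
    [e], and all other factors have modulus at most 1. *)
Lemma modC_digit_prod_le w k (e : R) : e <= 1 ->
  (forall i, modC (w i) <= 1) -> (forall i, (k <= i)%N -> modC (w i) <= e) ->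
  forall n, (d ^ k <= n)%N -> modC (digit_prod d w n) <= e.
Proof.
move=> e1; elim: k w => [|k IH] w w1 we n.
  elim/ltn_ind: n w w1 we => n IH w w1 we n0.
  rewrite digit_prodE // modCM modCX; have [nd|nd] := posnP (n %% d)%N.
    rewrite nd expr0 mul1r; apply: IH => [|i|i _|].
    - by rewrite ltn_Pdiv.
    - exact: w1.
    - exact: we.
    - rewrite divn_gt0; last by lia.
      by have := divn_eq n d; rewrite nd; case: (n %/ d)%N n0 => //=; lia.
  have e0 : 0 <= e by apply: le_trans (we 0%N isT); exact: modC_ge0.
  rewrite -[e]mulr1 ler_pM ?exprn_ge0 ?modC_ge0 //.
    rewrite -(prednK nd) exprS -[e]mulr1 ler_pM ?exprn_ge0 ?modC_ge0 ?we //.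
    by rewrite exprn_ile1 ?modC_ge0.
  by apply: modC_digit_prod_le1 => i; exact: w1.
move=> dn; rewrite digit_prodE // modCM modCX -[e]mul1r.
rewrite ler_pM ?exprn_ge0 ?modC_ge0 ?exprn_ile1 ?modC_ge0 //.
apply: IH => [i|i ki|]; [exact: w1 | exact: we |].
by rewrite leq_divRL; [rewrite -expnSr | lia].
Qed.

Lemma c0_digit_prod_shift w k :
  c0 (digit_prod d (shift k w)) -> c0 (digit_prod d w).
Proof.
elim: k w => [//|k IH] w /(IH (shift 1 w)) /c0P H; apply/c0P => e e0.
(* A bound, uniform in [n], for the factor of the last digit. *)
pose M := (1 + modC (w 0%N)) ^+ d.
have w0 := modC_ge0 (w 0%N); have M0 : 0 < M by rewrite exprn_gt0 //; lra.
have [|N HN] := H (e / M); first by rewrite divr_gt0.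
exists (N * d)%N => n Nn; rewrite digit_prodE // modCM modCX.
apply: (@le_lt_trans _ _ (M * modC (digit_prod d (shift 1 w) (n %/ d)))).
  rewrite ler_wpM2r ?modC_ge0 //.
  apply: (@le_trans _ _ ((1 + modC (w 0%N)) ^+ (n %% d))).
    by rewrite lerXn2r ?nnegrE //; lra.
  rewrite ler_weXn2l //; first lra.
  by rewrite ltnW // ltn_mod; lia.
by rewrite mulrC -ltr_pdivlMr // HN // leq_divRL //; lia.
Qed.

Lemma c0_digit_prod w : c0 w -> c0 (digit_prod d w).
Proof.
move=> /c0P w0; have [k Hk] := w0 1 ltr01; apply: (@c0_digit_prod_shift w k).
(* [e / 2] makes the final bound strict; the cap 1 is required by [modC_digit_prod_le]. *)
apply/c0P => e e0; pose e' := Num.min (e / 2) 1.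
have e'0 : 0 < e' by rewrite lt_min ltr01 andbT; lra.
have [N HN] := w0 e' e'0; exists (d ^ N)%N => n Nn.
apply: (@le_lt_trans _ _ e'); last by rewrite gt_min; apply/orP; left; lra.
apply: (@modC_digit_prod_le _ N) Nn => [|i|i Ni].
- by rewrite ge_min lexx orbT.
- by rewrite ltW // Hk // leq_addr.
- by rewrite ltW // HN // (leq_trans Ni) // leq_addl.
Qed.

End Modulus.

(** * Dynamics of the compositions *)

Section Dynamics.
Variables (R : realType) (d : nat) (dbar : nat -> nat) (p : nat -> R).
Hypothesis d1 : (1 < d)%N.
Hypothesis dbarE : forall j, (1 <= j)%N -> dbar j = d.
Hypothesis p01 : forall j, (1 <= j)%N -> 0 < p j <= 1.
Hypothesis p_to1 : p @ \oo --> (1 : R).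
Implicit Types (w : nat -> Cplx R) (l z : Cplx R).

Local Notation a l j := (modC (ftilde dbar p j l)).

Lemma modC_ftildeS l j : a l j.+1 = modC (multiplier dbar p l j) ^+ d.
Proof. by rewrite (ftildeS _ dbarE) modCX. Qed.

Lemma modC_multiplier_le l j :
  modC (multiplier dbar p l j) <= (a l j + 1 - p j.+1) / p j.+1.
Proof.
have /andP[p0 p1] := p01 (isT : (1 <= j.+1)%N).
rewrite modC_div // ler_pM2r ?invr_gt0 //.
apply: le_trans (modCD _ _) _; rewrite modCN modC_toC; lra.
Qed.

Lemma modC_multiplier_ge l j : 1 <= a l j ->
  a l j <= modC (multiplier dbar p l j).
Proof.
move=> a1; have /andP[p0 p1] := p01 (isT : (1 <= j.+1)%N).
rewrite modC_div // ler_pdivlMr //.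
have := modCD (ftilde dbar p j l - toC (1 - p j.+1)) (toC (1 - p j.+1)).
rewrite subrK modC_toC; last lra.
nra.
Qed.

(** Each step adds at least [a l j - 1], since [u ^+ 2 >= u * a l j >= u + (a l j - 1)] for the
    modulus [u] of the multiplier. *)
Lemma ftilde_escape l j n : 1 < a l j ->
  1 + n.+1%:R * (a l j - 1) <= a l (j + n).
Proof.
move=> a1; elim: n => [|n IH]; first by rewrite addn0 mul1r addrC subrK.
have s0 : 0 < a l j - 1 by lra.
have n0 : 0 <= n%:R :> R by [].
have b1 : a l j <= a l (j + n).
  by apply: le_trans IH; rewrite -[n.+1]addn1 natrD; nra.
have ub := modC_multiplier_ge (le_trans (ltW a1) b1).
rewrite addnS modC_ftildeS; set u := modC (multiplier _ _ _ _) in ub *.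
apply: (@le_trans _ _ (u ^+ 2)); last by rewrite ler_weXn2l //; lra.
rewrite -[n.+2]addn1 natrD mulrDl mul1r addrA.
have {IH} uX := le_trans IH ub; have {b1} us := le_trans b1 ub.
move: (n.+1%:R * _) uX => X uX.
have : 0 <= (u - 1) * (a l j - 1) by rewrite mulr_ge0 //; lra.
have : 0 <= u * (u - a l j) by rewrite mulr_ge0 //; lra.
rewrite expr2; lra.
Qed.

Lemma EsetP l : Eset dbar p l <-> forall j, a l j <= 1.
Proof.
split=> [|H].
  rewrite /Eset /= => /ereal_inf_lt[_ [V [N _ NV] <-] supV] j.
  rewrite leNgt; apply/negP => aj.
  have ub n : (N <= n)%N ->
      ((a l n)%:E <= ereal_sup ((fun j => (a l j)%:E) @` V))%E.
    by move=> Nn; apply: ereal_sup_ubound; exists n => //; exact: NV.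
  case: (ereal_sup _) supV ub => [M| |] // _ ub; last by have := ub N (leqnn N).
  (* Large enough for [j + n] to lie in the tail and for the linear growth to exceed [M]. *)
  pose n := (N + Num.bound (`|M| / (a l j - 1)))%N.
  have Nn : (N <= j + n)%N by rewrite /n; lia.
  have := ub (j + n)%N Nn; rewrite lee_fin => /(le_trans (ftilde_escape n aj)).
  apply/negP; rewrite -ltNge.
  have s0 : 0 < a l j - 1 by lra.
  have : `|M| / (a l j - 1) < n%:R.
    apply: lt_le_trans (archi_boundP _) _; first by rewrite divr_ge0 // ltW.
    by rewrite ler_nat leq_addl.
  rewrite ltr_pdivrMr // -[n.+1]addn1 natrD => Mn.
  have := ler_norm M; nra.
rewrite /Eset /=; apply: (@le_lt_trans _ _ 1%E); last exact: ltry.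
apply: le_trans (ereal_inf_lbound _) _.
  by exists setT => //; exact: filterT.
by apply: ge_ereal_sup => _ [j _ <-]; rewrite lee_fin.
Qed.

Lemma p_near1 (e : R) : 0 < e ->
  exists N, forall j, (N <= j)%N -> 1 - e < p j.+1.
Proof.
move=> e0; have /cvgrPdist_lt/(_ e e0)[N _ HN] := p_to1.
exists N => j Nj; have := HN j.+1 (leqW Nj) => /=.
by rewrite ltr_norml => /andP[]; lra.
Qed.

Lemma c0_multiplier l :
  c0 (multiplier dbar p l) <-> c0 (fun j => ftilde dbar p j l).
Proof.
split=> /c0P H; apply/c0P => e e0.
  have [|N HN] := H (Num.min e 1); first by rewrite lt_min e0 ltr01.
  exists N.+1 => -[//|n] Nn; have := HN n Nn.
  rewrite modC_ftildeS lt_min => /andP[ue u1].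
  by apply: le_lt_trans ue; rewrite ler_iXnr ?modC_ge0 // 1?ltW //; lia.
(* Then [a + 1 - p < e / 2 < e * p], the last step by [p > 1 / 2]. *)
have e4 : 0 < Num.min (e / 4) (1 / 2) by rewrite lt_min; apply/andP; split; lra.
have [N HN] := H _ e4; have [N' HN'] := p_near1 e4.
exists (N + N')%N => n Nn.
have := HN n (leq_trans (leq_addr _ _) Nn).
have := HN' n (leq_trans (leq_addl _ _) Nn).
rewrite ltrBlDr -ltrBlDl !lt_min => /andP[p1 p2] /andP[a1 a2].
apply: le_lt_trans (modC_multiplier_le l n) _.
rewrite ltr_pdivrMr; last lra.
nra.
Qed.

(** From [a + 1 <= 7 / 4 <= 4 * p] the multiplier has modulus [u <= a + 4 * (1 - p)]; this is at
    most [3 / 4 + 1 / 10 < 7 / 8], so [u ^+ 2 <= 7 / 8 * u]. *)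
Lemma ftilde_contract l j : 39 / 40 <= p j.+1 -> a l j <= 3 / 4 ->
  a l j.+1 <= 7 / 8 * (a l j + 4 * (1 - p j.+1)).
Proof.
move=> pj aj; have /andP[p0 p1] := p01 (isT : (1 <= j.+1)%N).
have a0 := modC_ge0 (ftilde dbar p j l).
have ux : modC (multiplier dbar p l j) <= a l j + 4 * (1 - p j.+1).
  apply: le_trans (modC_multiplier_le l j) _.
  by rewrite ler_pdivrMr //; nra.
rewrite modC_ftildeS; set u := modC (multiplier _ _ _ _) in ux *.
have u0 : 0 <= u by exact: modC_ge0.
apply: (@le_trans _ _ (u ^+ 2)); first by rewrite ler_wiXn2l //; lra.
rewrite expr2; nra.
Qed.

Lemma ftilde_trap l j k : (forall i, (j <= i)%N -> 39 / 40 <= p i.+1) ->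
  a l j <= 3 / 4 -> a l (j + k) <= 3 / 4.
Proof.
move=> pj aj; elim: k => [|k IH]; first by rewrite addn0.
have pk := pj (j + k)%N (leq_addr _ _).
by have := ftilde_contract pk IH; rewrite addnS; lra.
Qed.

Lemma c0_ftilde_trap l j : (forall i, (j <= i)%N -> 39 / 40 <= p i.+1) ->
  a l j <= 3 / 4 -> c0 (fun j => ftilde dbar p j l).
Proof.
move=> pj aj; apply/c0P => e e0; have [|N HN] := @p_near1 (e / 64); first lra.
(* The choice [e / 64] works because [7 / 8 * (e / 2 + 4 * (e / 64)) = 63 / 128 * e <= e / 2]. *)
have geo k : a l (j + N + k) <= e / 2 + (7 / 8) ^+ k.
  elim: k => [|k IH].
    rewrite addn0; have := ftilde_trap N pj aj; lra.
  have Nk : (j <= j + N + k)%N by rewrite -addnA leq_addr.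
  have ak : a l (j + N + k) <= 3 / 4 by rewrite -addnA; exact: ftilde_trap.
  have := ftilde_contract (pj _ Nk) ak; have := HN (j + N + k)%N.
  rewrite -addnA addnCA leq_addr => /(_ isT).
  rewrite [in a l (_ + k.+1)]addnS exprS -addnA addnCA; move: IH.
  rewrite -addnA addnCA; lra.
have := @cvg_expr R (7 / 8); rewrite ger0_norm; last lra.
have lt78 : 7 / 8 < 1 :> R by lra.
move=> /(_ lt78)/cvgr0Pnorm_lt/(_ (e / 2))[|M _ HM]; first lra.
exists (j + N + M)%N => n Mn.
have := geo (n - (j + N))%N; rewrite subnKC; last by lia.
have Mn' : (M <= n - (j + N))%N by lia.
have := HM _ Mn'; rewrite /= ger0_norm ?exprn_ge0 //; lra.
Qed.

Lemma continuous_ftilde j : continuous (ftilde dbar p j).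
Proof.
elim: j => [|j IH] z /=; first exact: cvg_id.
pose g z := (ftilde dbar p j z - toC (1 - p j.+1)) / toC (p j.+1).
have g_cvg : g x @[x --> z] --> g z.
  exact: (cvgM (cvgB (IH z) (cvg_cst _)) (cvg_cst _)).
suff gX n : g x ^+ n @[x --> z] --> g z ^+ n by exact: gX.
elim: n => [|n IHn]; first exact: (@cvg_cst (Cplx R) 1 (Cplx R) (nbhs z) _).
under eq_cvg do rewrite exprS; rewrite exprS.
exact: (cvgM g_cvg IHn).
Qed.

(** Continuity at a single late index sends all nearby orbits into the trapping disc. *)
Lemma c0_ftilde_interior l :
  c0 (fun j => ftilde dbar p j l) -> interior (Eset dbar p) l.
Proof.
move=> /c0P H; have [|N HN] := H (3 / 4); first lra.
have [|N' HN'] := @p_near1 (1 / 40); first lra.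
have pj i : (N + N' <= i)%N -> 39 / 40 <= p i.+1.
  by move=> Ni; have := HN' i (leq_trans (leq_addl _ _) Ni); lra.
have aN := HN (N + N')%N (leq_addr _ _).
have e0 : 0 < toC (3 / 4 - a l (N + N')) by rewrite /toC (ltcR 0); lra.
have := @continuous_ftilde (N + N')%N l => /cvgrPdist_lt/(_ _ e0) near_l.
apply: (@filterS _ (nbhs l) _ _ _ _ near_l) => z /=.
rewrite normr_modC /toC ltcR -modCN opprB => zl.
have az : a z (N + N') <= 3 / 4.
  have := modCD (ftilde dbar p (N + N') z - ftilde dbar p (N + N') l)
                (ftilde dbar p (N + N') l).
  rewrite subrK; lra.
(* An orbit that has left the unit disc never returns, so it cannot tend to 0. *)
apply/EsetP => j; rewrite leNgt; apply/negP => aj.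
have /c0P/(_ 1 ltr01)[M HM] := c0_ftilde_trap pj az.
have := ftilde_escape M aj; have := HM (j + M)%N (leq_addl _ _).
have : 0 <= M.+1%:R :> R by [].
nra.
Qed.

(** * Derivatives of the compositions and the critical orbits *)

Fixpoint ftilde_poly (j : nat) : {poly Cplx R} :=
  if j is k.+1 then
    ((ftilde_poly k - (toC (1 - p k.+1))%:P) * ((toC (p k.+1))^-1)%:P) ^+ d
  else 'X.

Lemma horner_ftilde_poly j z : (ftilde_poly j).[z] = ftilde dbar p j z.
Proof.
elim: j => [|j IH] /=; first by rewrite hornerX.
by rewrite /f dbarE // !hornerE IH.
Qed.

Lemma modC_deriv_ftilde_polyS j z :
  modC (ftilde_poly j.+1)^`().[z] =
  d%:R * modC (multiplier dbar p z j) ^+ d.-1 / p j.+1 *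
    modC (ftilde_poly j)^`().[z].
Proof.
have /andP[p0 p1] := p01 (isT : (1 <= j.+1)%N).
rewrite /= deriv_exp derivM derivB !derivC subr0 mulr0 addr0.
rewrite hornerMn !hornerE horner_ftilde_poly.
rewrite -/(multiplier dbar p z j) -mulr_natl modCM modCM modCX modC_div //.
rewrite (_ : d%:R = toC d%:R) ?modC_toC //; last by rewrite /toC rmorph_nat.
rewrite -!mulrA; congr (_ * _).
by rewrite mulrA mulrC [_ / p j.+1]mulrC.
Qed.

(* For d = 2 a disc of radius t^2 is invariant iff t^2 - p t + 1 - p <= 0, which
   has a solution t iff p >= 2 (sqrt 2 - 1); for equality, t = p / 2. *)
Lemma critical_disc s l j : 0 <= s -> s ^+ 2 + 2 * s = 1 -> 2 * s <= p j.+1 ->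
  a l j <= s ^+ 2 -> a l j.+1 <= s ^+ 2.
Proof.
move=> s0 s2 sp aj; have /andP[p0 p1] := p01 (isT : (1 <= j.+1)%N).
rewrite modC_ftildeS.
have us : modC (multiplier dbar p l j) <= s.
  apply: le_trans (modC_multiplier_le l j) _.
  by rewrite ler_pdivrMr //; nra.
have u0 := modC_ge0 (multiplier dbar p l j).
apply: (@le_trans _ _ (modC (multiplier dbar p l j) ^+ 2)).
  by rewrite ler_wiXn2l //; nra.
by rewrite lerXn2r.
Qed.

Hypothesis p_low : forall j, (1 <= j)%N -> 2 * (Num.sqrt 2 - 1) <= p j.

Lemma multiplier_neq0 l j : ~ c0 (fun j => ftilde dbar p j l) ->
  multiplier dbar p l j != 0.
Proof.
apply: contra_notN => /eqP uj; pose s : R := Num.sqrt 2 - 1.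
have sqrt2 : Num.sqrt 2 ^+ 2 = 2 :> R by rewrite sqr_sqrtr.
have sqrt1 : 1 <= Num.sqrt 2 :> R by rewrite -{1}sqrtr1 ler_sqrt //; lra.
have s2 : s ^+ 2 + 2 * s = 1 by move: sqrt2; rewrite /s; lra.
have s0 : 0 <= s by rewrite /s; lra.
have as2 k : a l (j.+1 + k) <= s ^+ 2.
  elim: k => [|k IH].
    rewrite addn0 modC_ftildeS uj modC0 expr0n gtn_eqF ?sqr_ge0 //; lia.
  by rewrite addnS; apply: critical_disc => //; exact: p_low.
have [|N HN] := @p_near1 (1 / 40); first lra.
apply: (@c0_ftilde_trap l (j.+1 + N)) => [i Ni|].
  by have := HN i (leq_trans (leq_addl _ _) Ni); lra.
(* The invariant disc of radius [s ^+ 2] lies in the trapping disc of radius [3 / 4]. *)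
by apply: le_trans (as2 N) _; nra.
Qed.

Lemma interior_c0_ftilde l :
  interior (Eset dbar p) l -> c0 (fun j => ftilde dbar p j l).
Proof.
move=> lE; have /EsetP al1 : Eset dbar p l by exact: interior_subset lE.
apply: contrapT => nc.
have u0 j : 0 < modC (multiplier dbar p l j).
  by rewrite modC_gt0 ?multiplier_neq0.
have [|N HN] := @p_near1 (1 / 40); first lra.
have alo j : (N <= j)%N -> 3 / 4 < a l j.
  move=> Nj; rewrite ltNge; apply/negP => aj; apply: nc.
  apply: c0_ftilde_trap aj => i ji.
  by have := HN i (leq_trans Nj ji); lra.
pose D j := modC (ftilde_poly j)^`().[l].
have D0 j : 0 < D j.
  elim: j => [|j IH]; first by rewrite /D /= derivX hornerC modC1.
  have /andP[p0 _] := p01 (isT : (1 <= j.+1)%N).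
  rewrite /D modC_deriv_ftilde_polyS mulr_gt0 // divr_gt0 // mulr_gt0 //.
    by rewrite ltr0n; lia.
  by rewrite exprn_gt0.
(* As [u <= 1] and [p <= 1], the factor [d * u ^+ d.-1 / p] is at least [2 * u ^+ d], and
   [u ^+ d = a l j.+1 > 3 / 4]. *)
have Dgrow j : (N <= j)%N -> 3 / 2 * D j <= D j.+1.
  move=> Nj; have /andP[p0 p1] := p01 (isT : (1 <= j.+1)%N).
  rewrite /D modC_deriv_ftilde_polyS -/(D j) (ler_pM2r (D0 j)) ler_pdivlMr //.
  have := alo j.+1 (leqW Nj); have := al1 j.+1; rewrite !modC_ftildeS.
  have := u0 j; set u := modC (multiplier _ _ _ _) => {}u0 ud1 ud.
  have u1 : u <= 1 by rewrite -(@expr_le1 _ d) // 1?ltW //; lia.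
  have : u ^+ d <= u ^+ d.-1 by exact: (ler_wiXn2l (ltW u0) u1 (leq_pred d)).
  have : 2 <= d%:R :> R by rewrite (ler_nat _ 2).
  nra.
have [e /= e0 eE] : nbhs_ball l (Eset dbar p) by apply/nbhs_ballP.
(* Halving puts the closed disc of radius [r] inside the open ball. *)
pose r := modC e / 2.
have eC : e = toC (modC e) by rewrite -normr_modC gtr0_norm.
have e0' : 0 < modC e by move: e0; rewrite {1}eC /toC (ltcR 0).
have r0 : 0 < r by rewrite /r; lra.
have cauchy j : D j * r <= 1.
  have r0C : 0 < toC r by rewrite /toC (ltcR 0).
  have := @cauchy_estimate _ (ftilde_poly j) l (toC r) r0C.
  rewrite normr_modC /toC -rmorphM (lecR _ 1); apply=> z zr.
  rewrite horner_ftilde_poly normr_modC /toC (lecR _ 1).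
  have /EsetP : Eset dbar p z; last exact.
  apply: eE; rewrite /ball /= /ball_ /= distrC; apply: le_lt_trans zr _.
  by rewrite eC /toC ltcR /r; lra.
(* This Bernoulli-type weakening of the growth by [(3 / 2) ^+ k] already contradicts [cauchy]. *)
have Dlin k : D N * (1 + k%:R / 2) <= D (N + k)%N.
  elim: k => [|k IH]; first by rewrite mul0r addr0 mulr1 addn0.
  have := Dgrow (N + k)%N (leq_addr _ _).
  rewrite addnS -[k.+1]addn1 natrD.
  have : 0 <= k%:R :> R by [].
  have := D0 N; nra.
have DNr : 0 < D N * r by rewrite mulr_gt0.
have k0 : 0 <= 2 / (D N * r) by rewrite divr_ge0 // ltW.
have := archi_boundP k0; rewrite ltr_pdivrMr //; set k := Num.bound _.
have := cauchy (N + k)%N; have := Dlin k; nra.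
Qed.

(** * The point spectrum in terms of orbits *)

Hypothesis dbar0 : dbar 0%N = 1%N.

Lemma point_spectrumP l :
  point_spectrum dbar p l <-> c0 (fun j => ftilde dbar p j l).
Proof.
rewrite -c0_multiplier; split=> [[w [/c0P wc [n wn] wl]]|uc].
  have wE := eigenvector_digit_prod d1 dbar0 dbarE p01 wl.
  have w0 : w 0%N != 0.
    by apply: contra_notN wn => /eqP w0; rewrite wE w0 mul0r.
  apply/c0P => e e0; have w0' := modC_gt0 w0.
  have [|N HN] := wc (modC (w 0%N) * e); first by rewrite mulr_gt0.
  (* The only nonzero digit of [d ^ j] is a 1 at index [j], so [digit_prod] reduces there to the
     single multiplier of index [j]. *)
  exists N => j Nj; have := HN (1 * d ^ j)%N.
  rewrite wE digit_prod_mulX // digit_prodE // modn_small // divn_small //.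
  rewrite digit_prod0 mulr1 expr1 /shift addn0 modCM ltr_pM2l //; apply.
  by rewrite mul1n (leq_trans Nj) // ltnW // ltn_expl.
exists (digit_prod d (multiplier dbar p l)); split.
- exact: c0_digit_prod.
- by exists 0%N; rewrite digit_prod0; apply/eqP; exact: oner_neq0.
- by move=> n; rewrite Sop_digit_prod.
Qed.

End Dynamics.

Theorem mainTheorem8 (R : realType) (d : nat) (dbar : nat -> nat) (p : nat -> R)
  (hd : (2 <= d)%N)
  (hdbar0 : dbar 0%N = 1%N)
  (hdbar : forall j : nat, (1 <= j)%N -> dbar j = d)
  (hp : forall j : nat, (1 <= j)%N -> 0 < p j <= 1)
  (hplim : p @ \oo --> (1 : R))
  (hplow : forall j : nat, (1 <= j)%N -> 2 * (Num.sqrt 2 - 1) <= p j) :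
  point_spectrum dbar p = interior (Eset dbar p).
Proof.
apply/seteqP; split=> l.
  move/(point_spectrumP hd hdbar hp hplim hdbar0).
  exact: (c0_ftilde_interior hd hdbar hp hplim).
move=> lE; apply/(point_spectrumP hd hdbar hp hplim hdbar0).
exact: (interior_c0_ftilde hd hdbar hp hplim hplow lE).
Qed.
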